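(* Let $(\mathcal{X},d)$ be a metric space with its Borel $\sigma$-algebra, let $\rho\colon \mathcal{X}\times\mathcal{X}\to\mathbb{R}$ be Borel measurable such that the associated Fréchet $\rho$-mean $\mathbb{M}$ is honest, and let $P$ be a Borel probability measure on $\mathcal{X}$ with $\rho(x,\cdot)\in L^1(P)$ for every $x\in\mathcal{X}$, such that $\mathbb{M}(P)$ is nonempty and non-unique, i.e. $|\mathbb{M}(P)|>1$. For $x\in\mathbb{M}(P)$ and $t\in(0,1]$ let $P_{x,t} := (1-t)P + t\delta_x$ and let $\bar P_{x,t}$ denote the unique element of $\mathbb{M}(P_{x,t})$. Let $n\in\mathbb{N}$ be a given sample size. Then for all $\epsilon\in(0,1)$ and all $p\ge 1$, $$\inf_{\hat P_n}\ \sup_{\substack{0<t\le\epsilon\\ x\in\mathbb{M}(P)}} \mathbb{E}_{P_{x,t}}\left[d^p\big(\hat P_n(X_1,\dots,X_n),\bar P_{x,t}\big)\right]\ \ge\ \frac12\left(\frac{\mathrm{diam}(\mathbb{M}(P))}{2}\right)^p,$$ where the infimum is taken over all measurable estimators $\hat P_n\colon\mathcal{X}^n\to\mathcal{X}$ and $X_1,\dots,X_n$ are i.i.d. random variables with law $P_{x,t}$. Further, for all $\eta>0$ arbitrarily small, $$\inf_{\hat P_n}\ \sup_{\substack{0<t\le\epsilon\\ x\in\mathbb{M}(P)}} \mathbb{P}_{P_{x,t}}\left(d\big(\hat P_n(X_1,\dots,X_n),\bar P_{x,t}\big)\ge\frac{\mathrm{diam}(\mathbb{M}(P))-\eta}{2}\right)\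 \ge\ \frac12 .$$
   Context: For a Borel measurable $\rho\colon\mathcal{X}\times\mathcal{X}\to\mathbb{R}$ and a Borel probability measure $Q$ on $\mathcal{X}$ with $\rho(x,\cdot)\in L^1(Q)$ for each $x\in\mathcal{X}$, the Fréchet $\rho$-function of $Q$ is $F_Q\colon\mathcal{X}\to\mathbb{R}$, $F_Q(x)=\mathbb{E}_{X\sim Q}[\rho(x,X)]$, and the Fréchet $\rho$-mean (set) of $Q$ is its set of minimizers $\mathbb{M}(Q)=\operatorname{argmin}_{x\in\mathcal{X}}F_Q(x)\subseteq\mathcal{X}$. The Fréchet $\rho$-mean is called honest if for every $x\in\mathcal{X}$ the function $\rho(\cdot,x)\colon\mathcal{X}\to\mathbb{R}$ is uniquely minimized by $x$. Under the hypotheses of the claim, $\mathbb{M}(P_{x,t})$ is a singleton for all $x\in\mathbb{M}(P)$ and $t\in(0,1]$, so $\bar P_{x,t}$ is well defined. The diameter of a nonempty set $A\subseteq\mathcal{X}$ is $\mathrm{diam}(A)=\sup_{x,y\in A}d(x,y)$, $\delta_x$ is the Dirac measure at $x$, and $\mathbb{P}_{Q}$, $\mathbb{E}_{Q}$ denote probability and expectation when $X_1,\dots,X_n$ are i.i.d. with law $Q$.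
   Formalization: The probability bound (the ''Further'' part) is stated only when diam(M(P)) is finite; when the diameter is infinite its threshold (diam(M(P)) − η)/2 is infinite and the bound is false. The expectation bound has no such restriction. *)

(* Defs.v *)
From HB Require Import structures.
From mathcomp Require Import all_boot all_order all_algebra.
From mathcomp Require Import all_classical all_reals all_analysis.
From mathcomp Require Import measurable_realfun.
From mathcomp Require Import ring lra.

Set Implicit Arguments.
Unset Strict Implicit.
Unset Printing Implicit Defensive.

Import Order.TTheory GRing.Theory Num.Theory.
Import numFieldNormedType.Exports.

Local Open Scope classical_set_scope.
Local Open Scope ring_scope.

(** Measurable types are pointed in MathComp-Analysis, so metric spaces are
    taken with a base point; it only serves as a default value. *)
#[short(type="pmetricType")]
HB.structure Definition PointedMetric (R : numDomainType) :=
  {M of Metric R M & Pointed M}.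

(** [borel T] is convertible to [T]; it carries the Borel sigma-algebra. *)
Notation borel T := (g_sigma_algebraType (@open T)).

Section iid_law.
Context d (T : measurableType d) (R : realType) (Q : probability T R).

Definition cons_pair n (z : T * n.-tuple T) : n.+1.-tuple T :=
  [tuple of z.1 :: z.2].

Lemma measurable_cons_pair n : measurable_fun setT (@cons_pair n).
Proof. exact: measurable_cons. Qed.

HB.instance Definition _ n :=
  isMeasurableFun.Build _ _ _ _ (@cons_pair n) (@measurable_cons_pair n).

(** The [n]-fold product measure, i.e. the joint law of [n] i.i.d. random
    variables of law [Q], for the product sigma-algebra on [n.-tuple T]. *)
Fixpoint iid_law n : probability (n.-tuple T) R :=
  match n with
  | 0 => @dirac _ (0.-tuple T) [tuple] R
  | m.+1 => distribution (Q \x iid_law m)%E (@cons_pair m)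
  end.

Lemma iid_law_box n (A : 'I_n -> set T) : (forall i, measurable (A i)) ->
  iid_law n [set xs | forall i, A i (tnth xs i)] = (\prod_(i < n) Q (A i))%E.
Proof.
elim: n A => [|n IH] A mA /=.
  rewrite big_ord0 diracE mem_set//= => -[]//.
rewrite big_ord_recl -IH; last by move=> i; exact: mA.
have mB : measurable [set xs : n.-tuple T | forall i, A (lift ord0 i) (tnth xs i)].
  rewrite [X in measurable X](_ : _ = \bigcap_(i : 'I_n)
      ((@tnth n T ^~ i) @^-1` A (lift ord0 i))).
    apply: fin_bigcap_measurable => [|i _]; first exact: finite_finset.
    by rewrite -[X in measurable X]setTI; exact: measurable_tnth.
  by apply/seteqP; split => xs /= H i; [move=> _|]; exact: H.
rewrite -product_measure1E//; congr (_ _).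
apply/seteqP; split => -[x xs] /= => [H|[Hx Hxs] i].
  split=> [|i]; first exact: (H ord0).
  by have := H (lift ord0 i); rewrite /cons_pair tnthS.
by case: (unliftP ord0 i) => [j|] ->; rewrite /cons_pair ?tnthS.
Qed.

End iid_law.

Section contamination.
Context d (T : measurableType d) (R : realType).
Variables (P : probability T R) (x : T) (t : {i01 R}).

(** [(1 - t) P + t \d_x], see [contamE]. *)
Definition contam : set T -> \bar R :=
  measure_add (mscale (1 - t%:num)%:nng P) (mscale t%:num%:nng \d_x).

HB.instance Definition _ := Measure.on contam.

Lemma contamE A :
  contam A = ((1 - t%:num)%:E * P A + t%:num%:E * \d_x A)%E.
Proof. by rewrite /contam measure_addE. Qed.

Let contam_setT : contam setT = 1%E.
Proof.
by rewrite contamE probability_setT diracT !mule1 -EFinD subrK.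
Qed.

HB.instance Definition _ := Measure_isProbability.Build _ _ _ contam contam_setT.

Lemma fine_integral_contam (f : T -> R) :
  P.-integrable setT (EFin \o f) ->
  fine (\int[contam]_y (f y)%:E)%E =
  (1 - t%:num) * fine (\int[P]_y (f y)%:E)%E + t%:num * f x.
Proof.
move=> fi; have mf := measurable_int _ fi.
have ge0E (g : T -> \bar R) : measurable_fun setT g -> (forall y, 0 <= g y)%E ->
    (\int[contam]_y g y =
     (1 - t%:num)%:E * \int[P]_y g y + t%:num%:E * g x)%E.
  move=> mg g0; rewrite /contam ge0_integral_measure_add//.
  by rewrite !ge0_integral_mscale// integral_dirac// diracT mul1e.
have fpos := integrable_pos_fin_num measurableT fi.
have fneg := integrable_neg_fin_num measurableT fi.
rewrite [in LHS]integralE [in RHS]integralE.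
rewrite !ge0E//; [|exact: measurable_funeneg|exact: measurable_funepos].
rewrite /= in fpos fneg *.
move: fpos fneg; rewrite -/(EFin \o f).
case: (\int[P]_y _)%E => // a _; case: (\int[P]_y _)%E => // b _.
rewrite funeposE funenegE /= -!EFin_max /=.
have mE : Num.max (f x) 0 - Num.max (- f x) 0 = f x.
  by have [h|h] := leP (f x) 0; have [h'|h'] := leP (- f x) 0; lra.
by rewrite -[in RHS]mE /=; ring.
Qed.

End contamination.

Section frechet.
Context {R : realType} {X : pmetricType R}.
Implicit Types (rho : X -> X -> R) (Q : probability (borel X) R) (A : set X).

Definition argmin (f : X -> R) : set X := [set x | forall y, f x <= f y].

(** Measurability for the Borel sigma-algebra of the product topology, which
    may be larger than the product sigma-algebra when [X] is not separable. *)
Definition borel_cost rho : Prop :=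
  measurable_fun [set: borel (X * X)%type] (fun z : X * X => rho z.1 z.2).

Definition L1_cost rho Q : Prop :=
  forall x, Q.-integrable [set: borel X] (EFin \o rho x).

Definition frechet_fun rho Q (x : X) : R := fine ('E_Q[rho x])%E.

Definition frechet_mean rho Q : set X := argmin (frechet_fun rho Q).

Definition honest rho : Prop :=
  forall x, argmin (fun y => rho y x) = [set x].

(** The unique element of [frechet_mean rho Q] when this set is a singleton;
    [get] returns the default point of [X] if the set is empty. *)
Definition frechet_point rho Q : X := get (frechet_mean rho Q).

(** Extended-real valued: [+oo] on unbounded sets. *)
Definition diam A : \bar R := ereal_sup [set (mdist x y)%:E | x in A & y in A].

(** Hence [frechet_point rho (contam P x t)] is well defined in this setting. *)
Lemma frechet_mean_contam rho (P : probability (borel X) R) (x : X)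
    (t : {i01 R}) :
  honest rho -> L1_cost rho P -> frechet_mean rho P x -> 0 < t%:num ->
  frechet_mean rho (contam P x t) = [set x].
Proof.
move=> hon iP Mx t0.
have FE y : frechet_fun rho (contam P x t) y =
    (1 - t%:num) * frechet_fun rho P y + t%:num * rho y x.
  by rewrite /frechet_fun unlock (fine_integral_contam _ _ (iP y)).
have t1 : 0 <= 1 - t%:num by rewrite subr_ge0.
have xmin y : rho x x <= rho y x.
  by have : argmin (rho ^~ x) x by [rewrite (hon x)]; exact.
apply/seteqP; split => [y My|_ -> y]; last first.
  by rewrite !FE lerD// ler_wpM2l// ?Mx// xmin.
have : argmin (rho ^~ x) y.
  move=> z; apply: le_trans (xmin z).
  have := My x; rewrite !FE => /le_trans; move/(_ _ (lerD (ler_wpM2l t1 (Mx y)) (lexx _))).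
  by rewrite lerD2l ler_pM2l.
by rewrite (hon x).
Qed.

End frechet.

(* Main.v *)
(** Le Cam's two-point argument.  Let [x] and [y] be Frechet means of [P] at
    distance at least [2 r].  The laws of [n]-samples of [contam P x t] and
    [contam P y t] both dominate [(1 - t) ^+ n] times that of [P], so with this
    weight the estimator carries no information on which of [x] and [y] is the
    target.  As it cannot be closer than [r] to both, under [P] it misses one of
    them by [r] with probability at least 1/2, and this one does not depend on
    [t].  Letting [t] tend to 0 removes the factor [(1 - t) ^+ n]. *)
Require Import Defs.
From HB Require Import structures.
From mathcomp Require Import all_boot all_order all_algebra.
From mathcomp Require Import all_classical all_reals all_analysis.
From mathcomp Require Import measurable_realfun.
From mathcomp Require Import lra.

Set Implicit Arguments.
Unset Strict Implicit.
Unset Printing Implicit Defensive.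

Import Order.TTheory GRing.Theory Num.Theory.
Import numFieldNormedType.Exports.

Local Open Scope classical_set_scope.
Local Open Scope ring_scope.

(** Induction on [n], slicing [B] along its first coordinate: [c ^+ n] is spent on the slices
    through the induction hypothesis, the last factor [c] on the law of that coordinate. *)
Lemma iid_law_le d (T : measurableType d) (R : realType)
    (P Q : probability T R) (c : R) n (B : set (n.-tuple T)) :
  0 <= c -> (forall A, measurable A -> (c%:E * P A <= Q A)%E) ->
  measurable B -> ((c ^+ n)%:E * iid_law P n B <= iid_law Q n B)%E.
Proof.
move=> c0 PQ; elim: n B => [|n IH] B mB; first by rewrite expr0 mul1e.
have mC : measurable (@cons_pair _ T n @^-1` B).
  by rewrite -[X in measurable X]setTI; exact: measurable_cons_pair.
have mfib (S : probability T R) :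
    measurable_fun setT (iid_law S n \o xsection (@cons_pair _ T n @^-1` B)).
  exact: measurable_fun_xsection.
rewrite /= /pushforward /product_measure1 exprSr EFinM -muleA.
(* Absorbing [c] into the measure turns the hypothesis into a setwise domination of [cP] by [Q],
   which passes to integrals of nonnegative functions. *)
pose cP : measure T R := mscale (NngNum c0) P.
have -> : (c%:E * \int[P]_x (iid_law P n \o
      xsection (@cons_pair _ T n @^-1` B)) x =
    \int[cP]_x (iid_law P n \o xsection (@cons_pair _ T n @^-1` B)) x)%E.
  by rewrite ge0_integral_mscale.
rewrite -ge0_integralZl//; last by rewrite lee_fin exprn_ge0.
apply: (@le_trans _ _ (\int[cP]_x (iid_law Q n \o
    xsection (@cons_pair _ T n @^-1` B)) x)%E).
  apply: ge0_le_integral => //.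
  - by move=> x _; rewrite mule_ge0// lee_fin exprn_ge0.
  - exact: measurable_funeM.
  - by move=> x _; apply: IH; exact: measurable_xsection.
by apply: ge0_le_measure_integral => // S mS; exact: PQ.
Qed.

Lemma contam_ge d (T : measurableType d) (R : realType) (P : probability T R)
    x (t : {i01 R}) (A : set T) :
  ((1 - t%:num)%:E * P A <= contam P x t A)%E.
Proof. by rewrite contamE leeDl// mule_ge0. Qed.

Lemma lee_right_lim (R : realType) (f : R -> R) (e l : R) (S : \bar R) :
  0 < e -> f t @[t --> 0^'+] --> l ->
  (forall t, 0 < t <= e -> ((f t)%:E <= S)%E) -> (l%:E <= S)%E.
Proof.
(* The value [-oo] is excluded by the bound at [t = e]. *)
move=> e0 fl; case: S => [s| |] fS; last by have := fS e; rewrite e0 lexx => /(_ isT).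
- rewrite lee_fin; apply: (cvgr_to_le fl); near=> t.
  rewrite -lee_fin fS//; apply/andP; split; near: t; [exact: nbhs_right_gt|exact: nbhs_right_le].
- by rewrite leey.
Unshelve. all: by end_near. Qed.

Lemma mdist_ball_open (R : realType) (X : metricType R) (x : X) (r : R) :
  open (ball x r).
Proof.
rewrite openE => y; rewrite ballEmdist /= => xyr.
apply/nbhs_ballP; exists (r - mdist x y); first by rewrite /= subr_gt0.
move=> z /=; rewrite !ballEmdist /= ltrBrDl.
exact: le_lt_trans (metric_triangle _ _ _).
Qed.

(** Open rays unbounded below generate the Borel sets of the line, and their preimages are open
    balls around [x]. *)
Lemma measurable_mdistl (R : realType) (X : pmetricType R) (x : X) :
  measurable_fun [set: borel X] (fun y : borel X => mdist (y : X) x).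
Proof.
apply: (measurability (@RGenInftyO.G R)); first exact: RGenInftyO.measurableE.
move=> _ [_ [r ->] <-]; rewrite setTI.
apply: sub_sigma_algebra; rewrite [X in open X](_ : _ = ball x r).
  exact: mdist_ball_open.
by rewrite ballEmdist; apply/seteqP; split => y /=; rewrite in_itv/= metric_sym.
Qed.

(** Serves both halves of the theorem: [S] is the worst-case risk of [f], and [c] the price of
    missing the target by [r], namely [r] to the power [p] for the moment bound and 1 for the
    probability bound. *)
Lemma two_point_lower_bound (R : realType) (X : pmetricType R)
    (P : probability (borel X) R) (n : nat) (eps c r : R) (x y : X)
    (f : {mfun n.-tuple (borel X) >-> borel X}) (S : \bar R) :
  0 < eps < 1 -> 0 <= c -> r * 2 <= mdist x y ->
  (forall z (t : {i01 R}), z = x \/ z = y -> 0 < t%:num <= eps ->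
    (c%:E * iid_law (contam P z t) n
       [set xs | (r <= mdist (f xs : X) z)%R] <= S)%E) ->
  ((2^-1 * c)%:E <= S)%E.
Proof.
move=> /andP[e0 e1] c0 rxy HS.
pose A z := [set xs | (r <= mdist (f xs : X) z)%R].
have mA z : measurable (A z).
  rewrite -[A z]setTI; apply: (measurable_fun_le (f := cst r)) => //.
  by apply: (measurableT_comp (measurable_mdistl z)).
(* The point [z] is chosen under [P], before [t] is introduced, so it stays fixed in the limit. *)
have [z zxy Az] : exists2 z, z = x \/ z = y & ((2^-1)%:E <= iid_law P n (A z))%E.
  have AT : A x `|` A y = setT.
    apply/seteqP; split => // xs _; rewrite /A /=.
    have [|ax] := leP r (mdist (f xs : X) x); first by left.
    have [|ay] := leP r (mdist (f xs : X) y); first by right.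
    have := metric_triangle x (f xs) y.
    by rewrite (metric_sym x (f xs)); lra.
  have : (1 <= iid_law P n (A x) + iid_law P n (A y))%E.
    rewrite -(probability_setT (iid_law P n)) -AT.
    exact: measureU2.
  have [|ax] := leP (2^-1)%:E (iid_law P n (A x)); first by exists x; [left|].
  have [|ay] := leP (2^-1)%:E (iid_law P n (A y)); first by exists y; [right|].
  rewrite leNgt => /negP[]; rewrite [ltRHS](_ : _ = (2^-1)%:E + (2^-1)%:E)%E.
    exact: lteD.
  by rewrite -EFinD; congr EFin; lra.
apply: (@lee_right_lim _ (fun t => (1 - t) ^+ n * (2^-1 * c)) eps) => //.
  apply: cvg_at_right_filter.
  rewrite [X in _ --> X](_ : _ = (1 - 0) ^+ n * (2^-1 * c)); last first.
    by rewrite subr0 expr1n mul1r.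
  apply: cvgMr_tmp.
  apply: (@cvg_comp _ _ _ (fun t : R => 1 - t) (fun t => t ^+ n) _
    (nbhs (1 - 0 : R))).
    by apply: cvgB; [exact: cvg_cst|exact: cvg_id].
  exact: exprn_continuous.
move=> t /andP[t0 te]; have t1 : t <= 1 := ltW (le_lt_trans te e1).
apply: le_trans (HS z (Itv01 (ltW t0) t1) zxy _); last by rewrite /= t0.
have := @iid_law_le _ _ _ P (contam P z (Itv01 (ltW t0) t1)) (1 - t) n (A z).
rewrite subr_ge0 => /(_ t1 (fun B _ => contam_ge _ _ _ _) (mA z)).
move=> /(lee_wpmul2l (_ : (0 <= c%:E)%E)) => H.
apply: le_trans (H _); last by rewrite lee_fin.
rewrite mulrA EFinM muleC EFinM lee_wpmul2l ?lee_fin//.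
by rewrite lee_wpmul2l ?lee_fin// exprn_ge0// subr_ge0.
Qed.

(** Markov's inequality for the power [p]: discard the integral off the event and bound the
    integrand below on it. *)
Lemma expectation_powR_ge d (T : measurableType d) (R : realType)
    (Q : probability T R) (g : T -> R) (p r : R) :
  measurable_fun setT g -> (forall z, 0 <= g z) -> 0 <= r -> 0 <= p ->
  ((r `^ p)%:E * Q [set z | (r <= g z)%R] <= 'E_Q[fun z => (g z `^ p)%R])%E.
Proof.
move=> mg g0 r0 p0.
have mA : measurable [set z | r <= g z].
  by rewrite -[X in measurable X]setTI; exact: (measurable_fun_le (f := cst r)).
have mgp : measurable_fun setT (fun z => (g z `^ p)%:E).
  apply/measurable_EFinP.
  exact: (measurableT_comp (@measurable_powR R p) mg).
rewrite -integral_cst// unlock.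
apply: (@le_trans _ _ (\int[Q]_(z in [set z | (r <= g z)%R]) (g z `^ p)%:E)%E).
  apply: ge0_le_integral => //.
  - by move=> z _; rewrite lee_fin powR_ge0.
  - exact: measurable_funTS.
  - by move=> z rg; rewrite lee_fin ge0_ler_powR ?nnegrE.
apply: ge0_subset_integral => //.
by move=> z _; rewrite lee_fin powR_ge0.
Qed.

(** However small [t] is, the target is pinned at [x]; hence two targets stay apart while the sample
    laws merge as [t] tends to 0. *)
Lemma frechet_point_contam (R : realType) (X : pmetricType R)
    (rho : X -> X -> R) (P : probability (borel X) R) (x : X) (t : {i01 R}) :
  honest rho -> L1_cost rho P -> frechet_mean rho P x -> 0 < t%:num ->
  frechet_point rho (contam P x t) = x.
Proof.
move=> hon iP Mx t0; rewrite /frechet_point frechet_mean_contam//.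
by apply: get_subset1 => // y z -> ->.
Qed.

Theorem theorem2p5 (R : realType) (X : pmetricType R) (rho : X -> X -> R)
    (P : probability (borel X) R) (n : nat) (eps : R) :
  borel_cost rho -> honest rho -> L1_cost rho P ->
  (exists x y, [/\ frechet_mean rho P x, frechet_mean rho P y & x <> y]) ->
  0 < eps < 1 ->
  (forall p : R, 1 <= p ->
    ((2^-1)%:E * (diam (frechet_mean rho P) / 2%:E) `^ p <=
     ereal_inf [set
       ereal_sup [set
         'E_(iid_law (contam P x t) n)[fun xs =>
            (mdist (Phat xs : X) (frechet_point rho (contam P x t)) `^ p)%R]
         | x in frechet_mean rho P & t in [set t : {i01 R} | (0 < t%:num <= eps)%R]]
       | Phat in [set: {mfun n.-tuple (borel X) >-> borel X}]])%E) /\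
  (diam (frechet_mean rho P) \is a fin_num ->
   forall eta : R, 0 < eta ->
    ((2^-1)%:E <=
     ereal_inf [set
       ereal_sup [set
         iid_law (contam P x t) n
           [set xs | ((diam (frechet_mean rho P) - eta%:E) / 2%:E <=
              (mdist (Phat xs : X) (frechet_point rho (contam P x t)))%:E)%E]
         | x in frechet_mean rho P & t in [set t : {i01 R} | (0 < t%:num <= eps)%R]]
       | Phat in [set: {mfun n.-tuple (borel X) >-> borel X}]])%E).
Proof.
move=> _ hon iP [x0 [y0 [Mx0 My0 _]]] eps01; split.
  move=> p p1; have p0 : 0 < p by exact: lt_le_trans p1.
  apply/ereal_infP => _ [f _ <-].
  set S := ereal_sup _.
  have HS x y : frechet_mean rho P x -> frechet_mean rho P y ->
      ((2^-1 * (mdist x y / 2) `^ p)%:E <= S)%E.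
    move=> Mx My; apply: (@two_point_lower_bound _ _ P n eps _ (mdist x y / 2) x y f) => //.
    - exact: powR_ge0.
    - by rewrite divfK.
    move=> z t zxy t0e; have Mz : frechet_mean rho P z by case: zxy => ->.
    have /andP[t0 _] := t0e.
    apply: le_trans (ereal_sup_ubound _); last by exists z => //; exists t => //.
    rewrite frechet_point_contam//.
    apply: expectation_powR_ge.
    - exact: (measurableT_comp (measurable_mdistl z)).
    - by move=> ?; exact: mdist_ge0.
    - by rewrite divr_ge0 ?mdist_ge0.
    - exact: ltW.
  have S0 : (0 <= S)%E.
    apply: le_trans (HS x0 y0 Mx0 My0).
    by rewrite lee_fin mulr_ge0// powR_ge0.
  have S20 : (0 <= 2%:E * S)%E by rewrite mule_ge0.
  (* Taking roots of order [p] isolates the distance in the pairwise bound [HS], so that the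
     supremum defining [diam] can be taken, even when it is infinite; the power is restored
     afterwards. *)
  have dS : (diam (frechet_mean rho P) / 2%:E <= (2%:E * S) `^ p^-1)%E.
    rewrite inver pnatr_eq0/= lee_pdivrMr//.
    apply/ereal_supP => _ [x Mx [y My <-]]; rewrite -lee_pdivrMr//.
    have -> : ((mdist x y)%:E * (2^-1)%:E = ((mdist x y / 2)%:E `^ p) `^ p^-1)%E.
      by rewrite -poweRrM divff ?gt_eqF// poweRe1// lee_fin divr_ge0// mdist_ge0.
    apply: gt0_ler_poweR; rewrite ?invr_ge0 ?(ltW p0)//.
    - by rewrite in_itv /= lee_fin powR_ge0 leey.
    - by rewrite in_itv/= S20 leey.
    have := HS x y Mx My.
    move=> /(lee_wpmul2l (_ : (0 <= 2%:E)%E)) => H.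
    by apply: le_trans (H _) => //; rewrite poweR_EFin -EFinM mulrA divff// mul1r.
  have d0 : (0 <= diam (frechet_mean rho P))%E.
    apply: (@le_trans _ _ (mdist x0 y0)%:E); first by rewrite lee_fin mdist_ge0.
    by apply: ereal_sup_ubound; exists x0 => //; exists y0.
  have : ((diam (frechet_mean rho P) / 2%:E) `^ p <= 2%:E * S)%E.
    have -> : (2%:E * S = ((2%:E * S) `^ p^-1) `^ p)%E.
      by rewrite -poweRrM mulVf ?gt_eqF// poweRe1.
    apply: gt0_ler_poweR; rewrite ?(ltW p0)//.
    - by rewrite in_itv/= leey andbT mule_ge0// inver pnatr_eq0/= lee_fin.
    - by rewrite in_itv/= poweR_ge0 leey.
  move=> /(lee_wpmul2l (_ : (0 <= (2^-1)%:E)%E)) => H.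
  by apply: le_trans (H _) _ => //; rewrite muleA -EFinM mulVf// mul1e.
move=> dfin eta eta0.
apply/ereal_infP => _ [f _ <-].
set S := ereal_sup _.
(* The diameter need not be attained; the slack [eta] yields a nearly extremal pair, since a finite
   diameter exceeds itself minus [eta]. *)
have [x [y [Mx My xy]]] : exists x y, [/\ frechet_mean rho P x,
    frechet_mean rho P y & (diam (frechet_mean rho P) - eta%:E <= (mdist x y)%:E)%E].
  apply: contrapT => H.
  suff : (diam (frechet_mean rho P) <= diam (frechet_mean rho P) - eta%:E)%E.
    by rewrite -(fineK dfin) -EFinB lee_fin; lra.
  apply/ereal_supP => _ [x Mx [y My <-]]; rewrite leNgt; apply/negP => /ltW xy.
  by apply: H; exists x, y.
rewrite -[2^-1]mulr1.
(* The radius is negative when [eta] exceeds the diameter, a case the two-point bound covers as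
   well. *)
apply: (@two_point_lower_bound _ _ P n eps 1
  ((fine (diam (frechet_mean rho P)) - eta) / 2) x y f) => //.
  by move: xy; rewrite -(fineK dfin) -EFinB lee_fin divfK.
move=> z t zxy t0e; have Mz : frechet_mean rho P z by case: zxy => ->.
have /andP[t0 _] := t0e.
apply: le_trans (ereal_sup_ubound _); last by exists z => //; exists t => //.
rewrite mul1e frechet_point_contam//.
by rewrite -(fineK dfin) -EFinB inver pnatr_eq0.
Qed.
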